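(* For any full rank lattice $\Lambda$ of $\mathbb{R}^d$, any set of data $\mathcal{F}=\{f_1,\dots,f_m\}\subset L^2(\mathbb{R}^d)$, any positive integer $\ell$, and any $A\in GL_d(\mathbb{R})$, $$\mathcal{E}^*(\mathcal{F},A\Lambda,\ell)=\mathcal{E}^*(D_A\mathcal{F},\Lambda,\ell).$$
   Context: For $A\in GL_d(\mathbb{R})$, $|A|=|\det A|$, $D_Af(x)=|A|^{1/2}f(Ax)$, and $D_A\mathcal{F}=\{D_Af_1,\dots,D_Af_m\}$. For a full rank lattice $\Lambda$ and a family $\Psi\subset L^2(\mathbb{R}^d)$, $S_\Lambda(\Psi)=\overline{\mathrm{span}}\{\psi(\cdot-\lambda):\lambda\in\Lambda,\psi\in\Psi\}$. For a closed subspace $W$ with orthogonal projection $\mathbb{P}_W$, $\mathcal{E}(\mathcal{F},W)=\sum_{i=1}^m\|f_i-\mathbb{P}_Wf_i\|^2$. $\mathcal{E}^*(\mathcal{F},\Lambda,\ell)$ is the minimum of $\mathcal{E}(\mathcal{F},S)$ over all $\Lambda$-invariant subspaces $S$ with at most $\ell$ generators, i.e. $S=S_\Lambda(\{\psi_1,\dots,\psi_\ell\})$ with $\psi_j\in L^2(\mathbb{R}^d)$ (the minimum is known to be attained). *)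

(* Defs.v *)
From HB Require Import structures.
From mathcomp Require Import all_boot all_order all_algebra complex.
From mathcomp Require Import all_classical all_reals all_analysis.

Set Implicit Arguments.
Unset Strict Implicit.
Unset Printing Implicit Defensive.
Import Order.TTheory GRing.Theory Num.Theory.
Import numFieldNormedType.Exports.

Local Open Scope classical_set_scope.
Local Open Scope ring_scope.

(* The sigma-algebra on matrices generated by the coordinates; for real column
   vectors this is the Borel sigma-algebra of R^n. *)
Definition measure_matrix_display : measure_display -> measure_display.
Proof. exact. Qed.

Section measurable_matrix.
Context {d : measure_display} {T : sigmaRingType d} (m n : nat).

Definition matrix_cylinders : set (set 'M[T]_(m, n)) :=
  [set C | exists i j (B : set T), measurable B /\
    C = (fun M : 'M[T]_(m, n) => M i j) @^-1` B].

Definition g_sigma_matrix : set (set 'M[T]_(m, n)) := <<s matrix_cylinders >>.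

Let matrix_set0 : g_sigma_matrix set0.
Proof. exact: sigma_algebra0. Qed.

Let matrix_setC A : g_sigma_matrix A -> g_sigma_matrix (~` A).
Proof. exact: sigma_algebraC. Qed.

Let matrix_bigcup (F : (set 'M[T]_(m, n))^nat) :
  (forall i, g_sigma_matrix (F i)) -> g_sigma_matrix (\bigcup_i (F i)).
Proof. exact: sigma_algebra_bigcup. Qed.

HB.instance Definition _ := @isMeasurable.Build (measure_matrix_display d)
  'M[T]_(m, n) g_sigma_matrix matrix_set0 matrix_setC matrix_bigcup.

Lemma measurable_coord (i : 'I_m) (j : 'I_n) :
  measurable_fun setT (fun M : 'M[T]_(m, n) => M i j).
Proof.
move=> _ B mB; rewrite setTI; apply: sub_sigma_algebra.
by exists i, j, B.
Qed.

End measurable_matrix.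

Lemma measurable_fun_matrix {d d' : measure_display} {S : measurableType d'}
    {T : measurableType d} (m n : nat) (f : S -> 'M[T]_(m, n)) :
  (forall i j, measurable_fun setT (fun x => f x i j)) ->
  measurable_fun setT f.
Proof.
move=> mf; apply: (@measurability _ _ _ _ _ _ (@matrix_cylinders _ T m n)) => //.
move=> _ [_ [i [j [B [mB ->]]]] <-].
exact: mf.
Qed.

Section lebesgue_measure_cV.
Context {R : realType}.

Definition cons_cV (n : nat) (p : measurableTypeR R * 'cV[R]_n) : 'cV[R]_n.+1 :=
  \col_i (if unlift ord0 i is Some j then p.2 j ord0 else p.1).

Definition uncons_cV (n : nat) (v : 'cV[R]_n.+1) :
    measurableTypeR R * 'cV[R]_n :=
  (v ord0 ord0, \col_j v (lift ord0 j) ord0).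

Lemma uncons_cVK (n : nat) : cancel (@uncons_cV n) (@cons_cV n).
Proof.
move=> v; apply/colP => i; rewrite mxE.
by case: unliftP => [j ->|->]; rewrite ?mxE.
Qed.

Lemma cons_cVK (n : nat) : cancel (@cons_cV n) (@uncons_cV n).
Proof.
case=> x v; congr pair; first by rewrite mxE unlift_none.
by apply/colP => j; rewrite !mxE liftK.
Qed.

Lemma measurable_cons_cV (n : nat) : measurable_fun setT (@cons_cV n).
Proof.
apply: measurable_fun_matrix => i j; rewrite /cons_cV.
case: (unliftP ord0 i) => [k ->|->].
- under eq_fun do rewrite mxE liftK.
  exact: measurableT_comp (measurable_coord _ _) measurable_snd.
- under eq_fun do rewrite mxE unlift_none.
  exact: measurable_fst.
Qed.

Lemma measurable_uncons_cV (n : nat) : measurable_fun setT (@uncons_cV n).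
Proof.
apply: measurable_fun_pair; first exact: measurable_coord.
apply: measurable_fun_matrix => i j.
under eq_fun do rewrite mxE.
exact: measurable_coord.
Qed.

Section step.
Variables (n : nat) (mu : {sigma_finite_measure set 'cV[R]_n -> \bar R}).

Definition lebesgue_cV_step : set 'cV[R]_n.+1 -> \bar R :=
  pushforward (lebesgue_measure \x mu)%E (@cons_cV n).

Let step_measure :=
  [the {measure set _ -> \bar R} of (lebesgue_measure \x mu)%E].

Let step0 : lebesgue_cV_step set0 = 0%E.
Proof. by rewrite /lebesgue_cV_step /pushforward preimage_set0 measure0. Qed.

Let step_ge0 A : (0 <= lebesgue_cV_step A)%E.
Proof. exact: (measure_ge0 step_measure). Qed.

Let step_sigma_additive : semi_sigma_additive lebesgue_cV_step.
Proof.
move=> F mF tF mUF; rewrite /lebesgue_cV_step /pushforward preimage_bigcup.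
have mcons A : measurable A -> measurable (@cons_cV n @^-1` A).
  by move=> mA; rewrite -[X in measurable X]setTI; exact: measurable_cons_cV.
apply: (@measure_semi_sigma_additive _ _ _ step_measure).
- by move=> k; exact: mcons.
- apply/trivIsetP => /= i j _ _ ij; rewrite -preimage_setI.
  by move/trivIsetP : tF => /(_ _ _ _ _ ij) ->//; rewrite preimage_set0.
- by rewrite -preimage_bigcup; exact: mcons.
Qed.

HB.instance Definition _ := isMeasure.Build _ _ _ lebesgue_cV_step
  step0 step_ge0 step_sigma_additive.

Let step_sigma_finite : sigma_finite setT lebesgue_cV_step.
Proof.
have /sigma_finiteP[F [FT ndF Foo]] := sigma_finiteT (@lebesgue_measure R).
have /sigma_finiteP[G [GT ndG Goo]] := sigma_finiteT mu.
exists (fun k => @uncons_cV n @^-1` (F k `*` G k)) => [|k].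
  rewrite -preimage_bigcup -(@preimage_setT _ _ (@uncons_cV n)); congr preimage.
  rewrite -setXTT FT GT predeqE => -[x y]; split.
    move=> [/= [a _ Fx] [b _ Gy]]; exists (maxn a b) => //; split.
    - by move: x Fx; exact/subsetPset/ndF/leq_maxl.
    - by move: y Gy; exact/subsetPset/ndG/leq_maxr.
  by move=> [a _ []/= ? ?]; split; exists a.
have [mF Fk] := Foo k; have [mG Gk] := Goo k; split.
  rewrite -[X in measurable X]setTI; apply: measurable_uncons_cV => //.
  exact: measurableX.
rewrite /lebesgue_cV_step /pushforward -comp_preimage.
rewrite (_ : @uncons_cV n \o _ = id); last exact/funext/cons_cVK.
by rewrite product_measure1E// lte_mul_pinfty// ge0_fin_numE.
Qed.

HB.instance Definition _ := Measure_isSigmaFinite.Build _ _ _ lebesgue_cV_step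
  step_sigma_finite.

End step.
(* Lebesgue measure on the Borel sets of R^n, as an iterated product of the
   one-dimensional one; R^0 is a point of mass 1. *)
Fixpoint lebesgue_measure_cV (n : nat) :
    {sigma_finite_measure set 'cV[R]_n -> \bar R} :=
  if n is k.+1 then lebesgue_cV_step (lebesgue_measure_cV k)
  else dirac (0 : 'cV[R]_0).

Lemma measurable_box_cV (n : nat) (I : 'I_n -> interval R) :
  measurable [set v : 'cV[R]_n | forall i, v i ord0 \in I i].
Proof.
rewrite (_ : [set _ | _] =
    \bigcap_(i in [set: 'I_n]) ((fun v : 'cV[R]_n => v i ord0) @^-1` [set` I i])).
  apply: fin_bigcap_measurable => // i _.
  by rewrite -[X in measurable X]setTI; apply: measurable_coord.
by apply/seteqP; split => v /= vI i; [move=> _; exact: vI|exact: (vI i)].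
Qed.

Lemma lebesgue_measure_cV_box (n : nat) (a b : 'I_n -> R) :
  (forall i, a i <= b i) ->
  lebesgue_measure_cV n [set v | forall i, v i ord0 \in `[a i, b i]] =
  (\prod_i (b i - a i))%:E.
Proof.
elim: n a b => [|n IHn] a b ab.
  by rewrite /= big_ord0 diracE mem_set//= => -[].
rewrite /= /lebesgue_cV_step /pushforward.
rewrite (_ : _ @^-1` _ = [set` `[a ord0, b ord0]] `*`
    [set v : 'cV[R]_n | forall j, v j ord0 \in
      `[a (lift ord0 j), b (lift ord0 j)]]); last first.
  apply/seteqP; split => [[x v] /= xv|[x v] [/= xI vI] i].
    split => [|j] /=; first by have := xv ord0; rewrite mxE unlift_none.
    by have := xv (lift ord0 j); rewrite mxE liftK.
  by rewrite mxE; case: unliftP => [j ->|->]; [exact: vI|exact: xI].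
rewrite product_measure1E//=; last exact: measurable_box_cV.
rewrite IHn//= lebesgue_measure_itv/= lte_fin big_ord_recl.
have := ab ord0; rewrite le_eqVlt => /predU1P[->|->].
  by rewrite ltxx subrr mul0e mul0r.
by rewrite -EFinD -EFinM.
Qed.

End lebesgue_measure_cV.

Section L2.
Context {R : realType} {d : nat}.
Local Notation V := 'cV[R]_d.
Local Notation mu := (lebesgue_measure_cV d).
Implicit Types (f g : V -> R[i]) (F W S : set (V -> R[i])).

(* Elements of L^2(R^d) (complex-valued) are represented by functions rather than
   by classes modulo almost everywhere equality. Norms, inner products and
   approximation errors only depend on the classes, and [L2closure] yields sets
   that are closed under almost everywhere equality within L^2. *)
Definition L2norm f : \bar R :=
  'N[mu]_2%:E[EFin \o (fun x => Normc.normc (f x))]%E.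

Definition L2 : set (V -> R[i]) := [set f |
  [/\ measurable_fun setT (fun x => complex.Re (f x)),
      measurable_fun setT (fun x => complex.Im (f x)) &
      (L2norm f < +oo)%E]].

Definition L2inner f g : R[i] :=
  Complex (\int[mu]_x complex.Re (f x * conjc (g x)))
          (\int[mu]_x complex.Im (f x * conjc (g x))).

Definition L2closure F : set (V -> R[i]) := [set f | L2 f /\
  forall e : R, 0 < e -> exists2 g, F g & (L2norm (fun x => (f x - g x)%R) < e%:E)%E].

Definition is_orthogonal_projection W f p : Prop :=
  W p /\ forall w, W w -> L2inner (fun x => f x - p x) w = 0.

(* The orthogonal projection onto a closed subspace exists and is unique up to
   almost everywhere equality. *)
Definition orthogonal_projection W f : V -> R[i] :=
  xget (fun=> 0) [set p | is_orthogonal_projection W f p].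

Definition translate (lam : V) f : V -> R[i] := fun x => f (x - lam).

Definition translates (Lam : set V) F : set (V -> R[i]) :=
  [set g | exists lam psi, [/\ Lam lam, F psi & g = translate lam psi]].

Definition lin_span F : set (V -> R[i]) :=
  [set g | exists (n : nat) (c : 'I_n -> R[i]) (h : 'I_n -> V -> R[i]),
    (forall k, F (h k)) /\ g = (fun x => \sum_(k < n) c k * h k x)].

Definition invariant_span (Lam : set V) F : set (V -> R[i]) :=
  L2closure (lin_span (translates Lam F)).

Definition full_rank_lattice (Lam : set V) : Prop :=
  exists2 B : 'M[R]_d, B \in unitmx &
    Lam = [set B *m map_mx intr z | z in [set: 'cV[int]_d]].

Definition invariant_subspaces (Lam : set V) (l : nat) : set (set (V -> R[i])) :=
  [set S | exists2 psi : 'I_l -> V -> R[i],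
    (forall j, L2 (psi j)) & S = invariant_span Lam (range psi)].

Definition approx_error (m : nat) (f : 'I_m -> V -> R[i]) W : R :=
  \sum_(i < m) fine (L2norm (fun x => f i x - orthogonal_projection W (f i) x)) ^+ 2.

(* The minimum of the error over all subspaces with at most l generators. The
   minimum is attained, hence it is the infimum of the set of errors, which is
   nonempty and bounded below by 0. *)
Definition optimal_error (m : nat) (f : 'I_m -> V -> R[i]) (Lam : set V)
    (l : nat) : R :=
  inf [set approx_error f S | S in invariant_subspaces Lam l].

Definition dilation (A : 'M[R]_d) f : V -> R[i] :=
  fun x => Complex (Num.sqrt `|\det A|) 0 * f (A *m x).

End L2.

(* Main.v *)
Require Import Defs.
From mathcomp Require Import all_boot all_order all_algebra complex.
From mathcomp Require Import all_classical all_reals all_analysis.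
From mathcomp Require Import ring lra measurable_realfun.
Import Order.TTheory GRing.Theory Num.Theory.
Set Implicit Arguments.
Unset Strict Implicit.
Unset Printing Implicit Defensive.
Local Open Scope classical_set_scope.
Local Open Scope ring_scope.

(** Up to normalization, dilation is a linear change of variables: the factor
    sqrt |det A| makes [dilation A] an isometry of L^2 that is onto because
    [dilation (invmx A)] inverts it, and
      dilation A (translate (A lam) psi) = translate lam (dilation A psi),
    so it carries the (A Lam)-invariant span of psi_1, ..., psi_l onto the
    Lam-invariant span of their dilations ([invariant_span_dilationE]). It also
    carries orthogonal projections to orthogonal projections, so each subspace
    on one side is matched with a subspace on the other side that has the same
    approximation error. The two infima are therefore taken over the same set of
    reals; one inclusion is [approx_errors_dilation], the other is the same
    lemma for the inverse matrix.

    The isometry rests on the linear change of variables for the iterated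
    product Lebesgue measure on column vectors ([integral_mulmx]). It is proved
    by induction on the dimension, for affine maps. In dimension one, uniqueness
    of Lebesgue measure gives it. A block triangular map with a scalar corner
    reduces by Tonelli to one variable and the smaller dimension: a lower
    triangular map is integrated first in the tail, where the leading coordinate
    only contributes a translation, and an upper triangular map is integrated
    first in the leading coordinate. An invertible matrix with nonzero corner is
    a product of two such maps (Schur complement), and a zero corner is made
    nonzero by adding a row to the first one, which is again a triangular map.

    Projections are representatives selected by choice, so [dilation A] need not
    send the selected projection to the selected one; it is enough that the
    distance to the subspace is the same for all choices ([projection_dist]).
    If one side has no projection, then neither has the other, and both selections
    return the zero function. *)

(** * Affine substitution on the line *)

Section affine1.
Context {R : realType}.
Local Notation mu := (@lebesgue_measure R).

Lemma measurable_affine1 (a b : R) :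
  measurable_fun setT ((fun x => a * x + b) : measurableTypeR R -> measurableTypeR R).
Proof. by apply: measurable_funD => //; apply: measurable_funM. Qed.

Lemma preimage_affine1_pos (a b c d : R) : 0 < a ->
  (fun x : R => a * x + b) @^-1` `]c, d] = `](c - b) / a, (d - b) / a]%classic.
Proof.
move=> a0; rewrite predeqE => x /=; rewrite !in_itv/= ltr_pdivrMr// ler_pdivlMr//.
by rewrite [x * a]mulrC ltrBlDr lerBrDr.
Qed.

Lemma preimage_affine1_neg (a b c d : R) : a < 0 ->
  (fun x : R => a * x + b) @^-1` `]c, d] = `[(d - b) / a, (c - b) / a[%classic.
Proof.
move=> a0; rewrite predeqE => x /=; rewrite !in_itv/= ler_ndivrMr// ltr_ndivlMr//.
by rewrite [x * a]mulrC ltrBlDr lerBrDr andbC.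
Qed.

(** Lebesgue measure is determined by its values on half-open intervals, and the
    scaled image measure has the right value there: the preimage of ]c, d] is an
    interval of length (d - c) / |a|, closed on the other side when a < 0. *)
Lemma lebesgue_measure_affine1 (a b : R) (A : set (measurableTypeR R)) :
  a != 0 -> measurable A ->
  (`|a|%:E * mu ((fun x => (a * x + b)%R) @^-1` A) = mu A)%E.
Proof.
move=> a0 mA.
pose phi (x : measurableTypeR R) : measurableTypeR R := a * x + b.
pose k : {nonneg R} := NngNum (normr_ge0 a).
rewrite [RHS](lebesgue_measure_unique (mu := mscale k (pushforward mu phi)))//=.
  exact: measurable_affine1.
move=> mphi _ [[c d]] _ <-.
rewrite /mscale/= /pushforward.
have [a1|a1|] := ltgtP a 0; last by move/eqP : a0.
- rewrite preimage_affine1_neg// !lebesgue_measure_itv/= !lte_fin.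
  rewrite ltr_nM2r ?invr_lt0// ltrD2r.
  case: ifPn => cd; last by rewrite mule0.
  by rewrite -!EFinD -EFinM ltr0_norm//; congr (_%:E); field; rewrite a0.
- rewrite preimage_affine1_pos// !lebesgue_measure_itv/= !lte_fin.
  rewrite ltr_pM2r ?invr_gt0// ltrD2r.
  case: ifPn => cd; last by rewrite mule0.
  by rewrite -!EFinD -EFinM gtr0_norm//; congr (_%:E); field; rewrite a0.
Qed.

End affine1.

(** * Affine substitution in R^n *)

Section scaled_pushforward.
Local Open Scope ereal_scope.
Context d (T : measurableType d) (R : realType) (mu : {measure set T -> \bar R}).
Variables (phi : T -> T) (c : R).
Hypotheses (mphi : measurable_fun setT phi) (c0 : (0 <= c)%R).
Hypothesis phiE : forall A, measurable A -> c%:E * mu (phi @^-1` A) = mu A.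

(** The integral is determined by the measure, and the hypothesis says that [mu]
    is its own image under [phi], scaled by [c]. *)
Lemma ge0_integral_substitution (f : T -> \bar R) :
  measurable_fun setT f -> (forall x, 0 <= f x) ->
  c%:E * \int[mu]_x f (phi x) = \int[mu]_x f x.
Proof.
move=> mf f0.
pose k : {nonneg R} := NngNum c0.
rewrite -[X in _ * X](ge0_integral_pushforward mphi mu measurableT mf)//.
rewrite -(ge0_integral_mscale _ measurableT k)//.
by apply: eq_measure_integral => A mA _; rewrite /mscale/= -phiE.
Qed.

End scaled_pushforward.

Section change_of_variables.
Local Open Scope ereal_scope.
Context {R : realType}.
Local Notation mu1 := (@lebesgue_measure R).
Local Notation mu n := (@lebesgue_measure_cV R n).

Lemma ge0_integral_affine1 (a b : R) (f : measurableTypeR R -> \bar R) :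
  a != 0%R -> measurable_fun setT f -> (forall x, 0 <= f x) ->
  `|a|%:E * \int[mu1]_x f (a * x + b)%R = \int[mu1]_x f x.
Proof.
move=> a0 mf f0.
apply: (ge0_integral_substitution (measurable_affine1 a b)) => // A mA.
exact: lebesgue_measure_affine1.
Qed.

Lemma ge0_integral_cons_cV n (f : 'cV[R]_n.+1 -> \bar R) :
  measurable_fun setT f -> (forall x, 0 <= f x) ->
  \int[mu n.+1]_v f v = \int[mu1 \x mu n]_p f (cons_cV p).
Proof.
move=> mf f0; rewrite -[RHS]/(\int[_]_(p in (@cons_cV R n) @^-1` setT) _).
by rewrite -(ge0_integral_pushforward (@measurable_cons_cV R n)).
Qed.

Lemma measurable_fun_cons_cV n (f : 'cV[R]_n.+1 -> \bar R) :
  measurable_fun setT f -> measurable_fun setT (fun p => f (@cons_cV R n p)).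
Proof. by move=> mf; apply: measurableT_comp mf _; exact: measurable_cons_cV. Qed.

(** Tonelli, integrating the tail first; in [ge0_integral_cons2] the leading
    coordinate is integrated first. *)
Lemma ge0_integral_cons1 n (f : 'cV[R]_n.+1 -> \bar R) :
  measurable_fun setT f -> (forall x, 0 <= f x) ->
  \int[mu n.+1]_v f v = \int[mu1]_x \int[mu n]_v f (cons_cV (x, v)).
Proof.
move=> mf f0; rewrite ge0_integral_cons_cV//.
by rewrite fubini_tonelli1//; exact: measurable_fun_cons_cV.
Qed.

Lemma ge0_integral_cons2 n (f : 'cV[R]_n.+1 -> \bar R) :
  measurable_fun setT f -> (forall x, 0 <= f x) ->
  \int[mu n.+1]_v f v = \int[mu n]_v \int[mu1]_x f (cons_cV (x, v)).
Proof.
move=> mf f0; rewrite ge0_integral_cons_cV//.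
by rewrite fubini_tonelli2//; exact: measurable_fun_cons_cV.
Qed.

Lemma cons_cVE n x (v : 'cV[R]_n) : cons_cV (x, v) = col_mx x%:M v :> 'cV[R]_(1 + n).
Proof.
apply/colP => i; rewrite !mxE; case: unliftP => [j ->|->].
  by rewrite (_ : lift ord0 j = rshift 1 j) ?(unsplitK (inr _))//; exact/val_inj.
rewrite (_ : ord0 = lshift n (ord0 : 'I_1)); last exact/val_inj.
by rewrite (unsplitK (inl _)) mxE eqxx mulr1n.
Qed.

Lemma measurable_affine_cV m n (A : 'M[R]_(m, n)) (b : 'cV[R]_m) :
  measurable_fun setT (fun v : 'cV[R]_n => (A *m v + b)%R).
Proof.
apply: measurable_fun_matrix => i j.
under eq_fun do rewrite !mxE.
apply: measurable_funD => //; apply: measurable_sum => k.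
by apply: measurable_funM => //; exact: measurable_coord.
Qed.

(** The translation [b] is part of the rule because fixing the leading coordinate
    in a linear map leaves an affine map of the tail, so that the induction on
    the dimension would not go through for linear maps alone. *)
Definition substitution_rule n (A : 'M[R]_n) :=
  forall (b : 'cV[R]_n) (f : 'cV[R]_n -> \bar R),
  measurable_fun setT f -> (forall x, 0 <= f x) ->
  `|\det A|%:E * \int[mu n]_v f (A *m v + b)%R = \int[mu n]_v f v.

Arguments substitution_rule {n} A.

Lemma substitution_ruleM n (A B : 'M[R]_n) :
  substitution_rule A -> substitution_rule B -> substitution_rule (A *m B).
Proof.
move=> hA hB b f mf f0; rewrite -[RHS](hA b)// -(hB 0%R (fun v => f (A *m v + b)%R))//.
- rewrite det_mulmx normrM EFinM -muleA; congr (_ * (_ * _)).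
  by apply: eq_integral => v _; rewrite addr0 mulmxA.
- by apply: measurableT_comp mf _; exact: measurable_affine_cV.
Qed.

Lemma lblock_affineE n (a s x : R) (c t v : 'cV[R]_n) (M : 'M[R]_n) :
  ((block_mx a%:M 0 c M : 'M[R]_(1 + n)) *m cons_cV (x, v) + cons_cV (s, t) =
  cons_cV (a * x + s, M *m v + (x *: c + t)))%R.
Proof.
rewrite !cons_cVE mul_block_col add_col_mx -scalar_mxM mul0mx addr0.
by rewrite mul_mx_scalar raddfD/= addrA [(x *: c + _)%R]addrC.
Qed.

Lemma ublock_affineE n (a s x : R) (b : 'rV[R]_n) (t v : 'cV[R]_n) (M : 'M[R]_n) :
  ((block_mx a%:M b 0 M : 'M[R]_(1 + n)) *m cons_cV (x, v) + cons_cV (s, t) =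
  cons_cV (a * x + ((b *m v) 0 0 + s), M *m v + t))%R.
Proof.
rewrite !cons_cVE mul_block_col add_col_mx -scalar_mxM mul0mx add0r.
by rewrite !raddfD/= addrA -mx11_scalar.
Qed.

(** For a fixed leading coordinate [x], the map acts on the tail as [M] followed by
    a translation that depends on [x] only. *)
Lemma substitution_rule_lblock n (a : R) (c : 'cV[R]_n) (M : 'M[R]_n) :
  a != 0%R -> substitution_rule M ->
  substitution_rule (block_mx a%:M 0 c M : 'M[R]_(1 + n)).
Proof.
move=> a0 hM b f mf f0; rewrite -(uncons_cVK b); case: (uncons_cV b) => s t.
rewrite det_lblock det_scalar1 normrM EFinM.
set L := block_mx _ _ _ _.
have mg : measurable_fun setT (fun v : 'cV[R]_n.+1 => f (L *m v + cons_cV (s, t))%R).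
  by apply: measurableT_comp mf _; exact: measurable_affine_cV.
rewrite [RHS]ge0_integral_cons1// ge0_integral_cons1//.
have mF := measurable_fun_cons_cV mf; have mG := measurable_fun_cons_cV mg.
rewrite -[RHS](ge0_integral_affine1 s a0); last 2 first.
- exact: (measurable_fun_fubini_tonelli_F _ mF).
- by move=> x; exact: integral_ge0.
rewrite -muleA -ge0_integralZl//; last 2 first.
- exact: (measurable_fun_fubini_tonelli_F _ mG).
- by move=> x _; exact: integral_ge0.
congr (_ * _); apply: eq_integral => x _.
rewrite -[RHS](hM (x *: c + t)%R); last 2 first.
- exact: (measurableT_comp mF (pair1_measurable (a * x + s)%R)).
- by [].
by congr (_ * _); apply: eq_integral => v _; rewrite lblock_affineE.
Qed.

(** For a fixed tail [v], the map acts on the leading coordinate as multiplication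
    by [a] followed by a translation that depends on [v] only. *)
Lemma substitution_rule_ublock n (a : R) (b : 'rV[R]_n) (M : 'M[R]_n) :
  a != 0%R -> substitution_rule M ->
  substitution_rule (block_mx a%:M b 0 M : 'M[R]_(1 + n)).
Proof.
move=> a0 hM b' f mf f0; rewrite -(uncons_cVK b'); case: (uncons_cV b') => s t.
rewrite det_ublock det_scalar1 normrM EFinM.
set L := block_mx _ _ _ _.
have mg : measurable_fun setT (fun v : 'cV[R]_n.+1 => f (L *m v + cons_cV (s, t))%R).
  by apply: measurableT_comp mf _; exact: measurable_affine_cV.
rewrite [RHS]ge0_integral_cons2// ge0_integral_cons2//.
have mF := measurable_fun_cons_cV mf; have mG := measurable_fun_cons_cV mg.
rewrite -[RHS](hM t); last 2 first.
- exact: (measurable_fun_fubini_tonelli_G _ mF).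
- by move=> x; exact: integral_ge0.
rewrite [`|a|%:E * _]muleC -muleA -ge0_integralZl//; last 2 first.
- exact: (measurable_fun_fubini_tonelli_G _ mG).
- by move=> x _; exact: integral_ge0.
congr (_ * _); apply: eq_integral => v _.
rewrite -[RHS](@ge0_integral_affine1 a ((b *m v) 0 0 + s)%R _ a0); last 2 first.
- exact: (measurableT_comp mF (pair2_measurable (M *m v + t)%R)).
- by [].
by congr (_ * _); apply: eq_integral => x _; rewrite ublock_affineE.
Qed.

(** Block elimination with a nonzero corner writes the matrix as a lower times an
    upper block triangular one, whose second diagonal block, the Schur complement,
    is again invertible. *)
Lemma substitution_rule_schur n (A : 'M[R]_(1 + n)) :
  (forall M : 'M[R]_n, M \in unitmx -> substitution_rule M) ->
  A \in unitmx -> ulsubmx A ord0 ord0 != 0%R -> substitution_rule A.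
Proof.
move=> IH; rewrite -{1 3}(submxK A); set a := ulsubmx A; set b := ursubmx A.
set c := dlsubmx A; set D := drsubmx A => Au a0.
rewrite [a]mx11_scalar in Au *; move: (a ord0 ord0) Au a0 => {}a Au a0.
have AE : block_mx a%:M b c D =
    (block_mx 1%:M 0 (a^-1 *: c) 1%:M : 'M[R]_(1 + n)) *m
    block_mx a%:M b 0 (D - a^-1 *: c *m b).
  rewrite mulmx_block !mul1mx !mul0mx !addr0 mul_mx_scalar scalerA.
  by rewrite divff// scale1r addrC subrK.
rewrite AE in Au *; apply: substitution_ruleM.
  by apply: substitution_rule_lblock (oner_neq0 _) _; apply: IH; exact: unitmx1.
apply: substitution_rule_ublock => //; apply: IH.
move: Au; rewrite unitmx_mul => /andP[_].
by rewrite !unitmxE det_ublock unitrM => /andP[].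
Qed.

Lemma substitution_rule_unitmx n (A : 'M[R]_n) : A \in unitmx -> substitution_rule A.
Proof.
elim: n A => [|n IH] A Au.
  move=> b f mf f0; rewrite det_mx00 normr1 mul1e.
  by apply: eq_integral => v _; congr f; rewrite [LHS]flatmx0 [RHS]flatmx0.
have ulE (B : 'M[R]_n.+1) :
    @ulsubmx _ 1 n 1 n B ord0 ord0 = B ord0 ord0.
  by rewrite !mxE; congr (B _ _); exact/val_inj.
have [A0|A0] := eqVneq (A ord0 ord0) 0%R; last first.
  by apply: substitution_rule_schur; rewrite ?ulE.
have [j Aj] : exists j, A (lift ord0 j) ord0 != 0%R.
  apply/existsP; apply: contraTT Au; rewrite negb_exists => /forallP Aj.
  rewrite unitmxE unitfE negbK (expand_det_col A ord0) big1// => i _.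
  case: (unliftP ord0 i) => [k ->|->]; last by rewrite A0 mul0r.
  by rewrite (eqP (negbNE (Aj k))) mul0r.
(* Left multiplication by E u adds to the first row the combination of the other
   rows with weights u. *)
pose E (u : 'rV[R]_n) : 'M[R]_(1 + n) := block_mx 1%:M u 0 1%:M.
have EE u v : (E u *m E v = E (u + v))%R.
  by rewrite /E mulmx_block !mul1mx !mulmx1 !mul0mx !mulmx0 !addr0 add0r [(v + u)%R]addrC.
have E0 : E 0%R = 1%:M by rewrite /E -scalar_mx_block.
have ruleE u : substitution_rule (E u).
  by apply: substitution_rule_ublock (oner_neq0 _) _; apply: IH; exact: unitmx1.
pose u : 'rV[R]_n := delta_mx ord0 j.
have -> : A = E (- u)%R *m (E u *m A) by rewrite mulmxA EE addNr E0 mul1mx.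
apply: substitution_ruleM => //; apply: substitution_rule_schur => //.
  rewrite unitmx_mul Au andbT.
  by have [] := mulmx1_unit (etrans (EE u (- u)%R) (etrans (congr1 E (subrr u)) E0)).
rewrite ulE mxE big_ord_recl A0 mulr0 add0r.
have Eu k : E u ord0 (lift ord0 k) = u ord0 k.
  rewrite -(block_mxEur 1%:M u 0 1%:M) /E.
  by congr (block_mx _ _ _ _ _ _); exact/val_inj.
rewrite (bigD1 j)//= big1 ?addr0 => [|k kj].
  by rewrite Eu mxE !eqxx mul1r.
by rewrite Eu mxE eqxx (negbTE kj) mul0r.
Qed.

End change_of_variables.

(** The integral is the difference of those of the positive and negative parts, and
    each part obeys the substitution rule, also when its integral is infinite. *)
Lemma integral_mulmx {R : realType} d (A : 'M[R]_d) (h : 'cV[R]_d -> \bar R) :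
  A \in unitmx -> measurable_fun setT h ->
  (\int[lebesgue_measure_cV d]_x (`|\det A|%:E * h (A *m x)) =
   \int[lebesgue_measure_cV d]_x h x)%E.
Proof.
move=> Au mh.
have mA : measurable_fun setT (fun x : 'cV[R]_d => A *m x).
  by under eq_fun do rewrite -[_ *m _]addr0; exact: measurable_affine_cV.
have ge0 (g : 'cV[R]_d -> \bar R) : measurable_fun setT g ->
    (forall x, 0 <= g x)%E ->
    (\int[lebesgue_measure_cV d]_x (`|\det A|%:E * g (A *m x)) =
     \int[lebesgue_measure_cV d]_x g x)%E.
  move=> mg g0; rewrite ge0_integralZl//; last exact: measurableT_comp mg mA.
  rewrite -(substitution_rule_unitmx Au 0 mg g0); congr (_ * _)%E.
  by apply: eq_integral => x _; rewrite addr0.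
rewrite integralE [RHS]integralE.
rewrite (ge0_funeposM (fun x => h (A *m x)))// (ge0_funenegM (fun x => h (A *m x)))//.
rewrite -(ge0 h^\+%E)//; last exact: measurable_funepos.
rewrite -(ge0 h^\-%E)//; last exact: measurable_funeneg.
by rewrite (funepos_comp h (mulmx A)) (funeneg_comp h (mulmx A)).
Qed.

(** * Square integrable functions *)

Section dilation_L2.
Context {R : realType} {d : nat}.
Local Notation V := 'cV[R]_d.
Local Notation mu := (lebesgue_measure_cV d).
Implicit Types (f g p q u v w : V -> R[i]) (F W : set (V -> R[i])) (A : 'M[R]_d).

Definition measurable_cfun f :=
  measurable_fun setT (fun x => complex.Re (f x)) /\
  measurable_fun setT (fun x => complex.Im (f x)).

Lemma ReD (a b : R[i]) : complex.Re (a + b) = complex.Re a + complex.Re b.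
Proof. by case: a b => [? ?] []. Qed.
Lemma ImD (a b : R[i]) : complex.Im (a + b) = complex.Im a + complex.Im b.
Proof. by case: a b => [? ?] []. Qed.
Lemma ReM (a b : R[i]) :
  complex.Re (a * b) = complex.Re a * complex.Re b - complex.Im a * complex.Im b.
Proof. by case: a b => [? ?] []. Qed.
Lemma ImM (a b : R[i]) :
  complex.Im (a * b) = complex.Re a * complex.Im b + complex.Im a * complex.Re b.
Proof. by case: a b => [? ?] []. Qed.
Lemma ReJ (a : R[i]) : complex.Re (conjc a) = complex.Re a.
Proof. by case: a. Qed.
Lemma ImJ (a : R[i]) : complex.Im (conjc a) = - complex.Im a.
Proof. by case: a. Qed.
Lemma ReN (a : R[i]) : complex.Re (- a) = - complex.Re a.
Proof. by case: a. Qed.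
Lemma ImN (a : R[i]) : complex.Im (- a) = - complex.Im a.
Proof. by case: a. Qed.

Lemma measurable_cfunD f g : measurable_cfun f -> measurable_cfun g ->
  measurable_cfun (fun x => f x + g x).
Proof.
move=> [? ?] [? ?]; split.
- by under eq_fun do rewrite ReD; exact: measurable_funD.
- by under eq_fun do rewrite ImD; exact: measurable_funD.
Qed.

Lemma measurable_cfunM f g : measurable_cfun f -> measurable_cfun g ->
  measurable_cfun (fun x => f x * g x).
Proof.
move=> [? ?] [? ?]; split.
- by under eq_fun do rewrite ReM; apply: measurable_funB; exact: measurable_funM.
- by under eq_fun do rewrite ImM; apply: measurable_funD; exact: measurable_funM.
Qed.

Lemma measurable_cfun_cst (c : R[i]) : measurable_cfun (fun=> c).
Proof. by split. Qed.

Lemma measurable_cfunB f g : measurable_cfun f -> measurable_cfun g ->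
  measurable_cfun (fun x => f x - g x).
Proof.
move=> mf mg; apply: measurable_cfunD => //.
under eq_fun do rewrite -mulN1r.
by apply: measurable_cfunM => //; exact: measurable_cfun_cst.
Qed.

Lemma measurable_cfunJ f : measurable_cfun f -> measurable_cfun (fun x => conjc (f x)).
Proof.
move=> [? ?]; split; first by under eq_fun do rewrite ReJ.
by under eq_fun do rewrite ImJ; exact: measurableT_comp.
Qed.

Lemma measurable_cfun_comp_affine f A (b : V) : measurable_cfun f ->
  measurable_cfun (fun x => f (A *m x + b)).
Proof.
have mA := measurable_affine_cV A b.
by move=> [mr mi]; split; [exact: (measurableT_comp mr mA)|
  exact: (measurableT_comp mi mA)].
Qed.

Lemma measurable_cfun_dilation A f : measurable_cfun f -> measurable_cfun (dilation A f).
Proof.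
move=> mf; apply: measurable_cfunM; first exact: measurable_cfun_cst.
by under eq_fun do rewrite -[_ *m _]addr0; exact: measurable_cfun_comp_affine.
Qed.

Lemma measurable_cfun_translate (b : V) f : measurable_cfun f ->
  measurable_cfun (translate b f).
Proof.
rewrite /translate => mf; under eq_fun do rewrite -[X in f (X - b)]mul1mx.
exact: measurable_cfun_comp_affine.
Qed.

Lemma lin_span_measurable F : (forall f, F f -> measurable_cfun f) ->
  forall f, lin_span F f -> measurable_cfun f.
Proof.
move=> mF _ [n [c [h [Fh ->]]]].
elim: n c h Fh => [|n IH] c h Fh.
  by under eq_fun do rewrite big_ord0; exact: measurable_cfun_cst.
under eq_fun do rewrite big_ord_recl.
apply: measurable_cfunD; last by apply: IH => k; exact: Fh.
by apply: measurable_cfunM; [exact: measurable_cfun_cst|exact/mF].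
Qed.

(** The squared norm as an extended real, with an integrand that is a polynomial in
    the real and imaginary parts, hence measurable without a square root. *)
Definition sqnorm_int f := (\int[mu]_x (complex.Re (f x * conjc (f x)))%:E)%E.

Lemma sqnormE (z : R[i]) : complex.Re (z * conjc z) = Normc.normc z ^+ 2.
Proof.
by case: z => a b; rewrite sqr_sqrtr ?addr_ge0 ?sqr_ge0//= mulrN opprK !expr2.
Qed.

Lemma sqnorm_int_ge0 f : (0 <= sqnorm_int f)%E.
Proof. by apply: integral_ge0 => x _; rewrite lee_fin sqnormE sqr_ge0. Qed.

Lemma L2normE f : L2norm f = (sqnorm_int f `^ 2^-1)%E.
Proof.
rewrite /L2norm unlock /sqnorm_int; congr (_ `^ _)%E; apply: eq_integral => x _ /=.
by rewrite powR_mulrn ?normr_ge0// real_normK ?num_real// sqnormE.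
Qed.

Lemma L2P f : L2 f <-> measurable_cfun f /\ (sqnorm_int f < +oo)%E.
Proof.
rewrite /L2/= L2normE; split=> [[mr mi lt]|[[mr mi] lt]].
  by split=> //; apply: lty_poweRy lt.
by split=> //; exact: poweR_lty.
Qed.

(** Both sides vanish when the norm is infinite, as [fine] sends infinity to 0. *)
Lemma L2norm_sqr f : fine (L2norm f) ^+ 2 = complex.Re (L2inner f f).
Proof.
rewrite L2normE /= /Rintegral -/(sqnorm_int f).
case: (sqnorm_int f) (sqnorm_int_ge0 f) => [r||]//=.
- by rewrite lee_fin => r0; rewrite powR12_sqrt// sqr_sqrtr.
- by move=> _; rewrite invr_eq0 pnatr_eq0/= expr0n.
Qed.

Lemma measurable_inner u v : measurable_cfun u -> measurable_cfun v ->
  measurable_cfun (fun x => u x * conjc (v x)).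
Proof. by move=> mu_ mv; apply: measurable_cfunM => //; exact: measurable_cfunJ. Qed.

(** Domination by |u|^2 + |v|^2. *)
Lemma integrable_inner u v : L2 u -> L2 v ->
  mu.-integrable setT (EFin \o (fun x => complex.Re (u x * conjc (v x)))).
Proof.
have intS w : L2 w ->
    mu.-integrable setT (EFin \o (fun x => complex.Re (w x * conjc (w x)))).
  move=> /L2P[mw lt]; apply/integrableP; split.
    by apply/measurable_EFinP; exact: (measurable_inner mw mw).1.
  rewrite (eq_integral (EFin \o (fun x => complex.Re (w x * conjc (w x)))))// => x _ /=.
  by rewrite ger0_norm// sqnormE sqr_ge0.
move=> L2u L2v; have /L2P[mu_ _] := L2u; have /L2P[mv _] := L2v.
apply: le_integrable (integrableD measurableT (intS _ L2u) (intS _ L2v)) => //.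
  by apply/measurable_EFinP; exact: (measurable_inner mu_ mv).1.
move=> x _ /=; rewrite lee_fin.
rewrite [leRHS]ger0_norm ?addr_ge0 ?sqnormE ?sqr_ge0// -!sqnormE.
rewrite !ReM !ReJ !ImJ; case: (u x) (v x) => [a b] [a' b'] /=.
have := (sqr_ge0 (a + a'), sqr_ge0 (a - a'), sqr_ge0 (b + b'), sqr_ge0 (b - b')).
by rewrite ler_norml; move=> [[[]]] *; apply/andP; split; nra.
Qed.

(** Domination of |f - g|^2 by 2 |f|^2 + 2 |g|^2. *)
Lemma L2B f g : L2 f -> L2 g -> L2 (fun x => f x - g x).
Proof.
move=> L2f L2g; have /L2P[mf lf] := L2f; have /L2P[mg lg] := L2g.
have mfg := measurable_cfunB mf mg.
apply/L2P; split => //.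
have S w : L2 w ->
    mu.-integrable setT (fun x => 2%:E * (complex.Re (w x * conjc (w x)))%:E)%E.
  by move=> L2w; apply: integrableZl => //; exact: integrable_inner.
have : mu.-integrable setT
    (EFin \o (fun x => complex.Re ((f x - g x) * conjc (f x - g x)))).
  apply: le_integrable (integrableD measurableT (S _ L2f) (S _ L2g)) => //.
    by apply/measurable_EFinP; exact: (measurable_inner mfg mfg).1.
  move=> x _ /=; rewrite lee_fin.
  rewrite [leRHS]ger0_norm ?addr_ge0 ?mulr_ge0 ?sqnormE ?sqr_ge0//.
  rewrite ger0_norm ?sqr_ge0// -!sqnormE.
  rewrite !(ReM, ReJ, ImJ, ReD, ImD, ReN, ImN).
  case: (f x) (g x) => [a b] [a' b'] /=.
  by have := sqr_ge0 (a + a'); have := sqr_ge0 (b + b'); nra.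
by move/integrable_lty; apply.
Qed.

Lemma Re_L2innerB u v w : L2 u -> L2 v -> L2 w ->
  complex.Re (L2inner u (fun x => v x - w x)) =
  complex.Re (L2inner u v) - complex.Re (L2inner u w).
Proof.
move=> L2u L2v L2w /=; rewrite -RintegralB//; try exact: integrable_inner.
by apply: eq_Rintegral => x _; rewrite !(ReM, ReJ, ImJ, ReD, ImD, ReN, ImN); ring.
Qed.

Lemma Re_L2innerC u v : complex.Re (L2inner u v) = complex.Re (L2inner v u).
Proof.
by rewrite /=; apply: eq_Rintegral => x _; rewrite !(ReM, ReJ, ImJ); ring.
Qed.

(** As p and q lie in W, the residuals r = f - p and s = f - q satisfy
    <r, r> = <r, f> = <r, s> and <s, s> = <s, f> = <s, r>, and the real part of the
    inner product is symmetric. *)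
Lemma projection_dist W f p q : W `<=` L2 -> L2 f ->
  is_orthogonal_projection W f p -> is_orthogonal_projection W f q ->
  fine (L2norm (fun x => f x - p x)) ^+ 2 = fine (L2norm (fun x => f x - q x)) ^+ 2.
Proof.
move=> WL2 L2f [Wp op] [Wq oq]; have L2p := WL2 _ Wp; have L2q := WL2 _ Wq.
have L2fp := L2B L2f L2p; have L2fq := L2B L2f L2q.
have E r s : W r -> W s -> L2 r -> L2 s ->
    is_orthogonal_projection W f r ->
    complex.Re (L2inner (fun x => f x - r x) (fun x => f x - s x)) =
    complex.Re (L2inner (fun x => f x - r x) f).
  move=> Wr Ws L2r L2s [_ or]; rewrite Re_L2innerB//; last exact: L2B.
  by rewrite (or _ Ws) subr0.
by rewrite !L2norm_sqr (E p p)// (E q q)// -(E p q)// Re_L2innerC (E q p).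
Qed.

(** * Dilations *)

Lemma dilation_mulJ A f g x :
  complex.Re (dilation A f x * conjc (dilation A g x)) =
    `|\det A| * complex.Re (f (A *m x) * conjc (g (A *m x))) /\
  complex.Im (dilation A f x * conjc (dilation A g x)) =
    `|\det A| * complex.Im (f (A *m x) * conjc (g (A *m x))).
Proof.
have E := sqr_sqrtr (normr_ge0 (\det A)); rewrite /dilation.
case: (f _) (g _) => [a b] [a' b'] /=; move: (Num.sqrt _) E => s <-.
by split; ring.
Qed.

Lemma sqnorm_int_dilation A f : A \in unitmx -> measurable_cfun f ->
  sqnorm_int (dilation A f) = sqnorm_int f.
Proof.
move=> Au mf; rewrite /sqnorm_int -[RHS](integral_mulmx Au).
  by apply: eq_integral => x _; rewrite (dilation_mulJ A _ _ _).1 EFinM.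
by apply/measurable_EFinP; exact: (measurable_inner mf mf).1.
Qed.

Lemma L2norm_dilation A f : A \in unitmx -> measurable_cfun f ->
  L2norm (dilation A f) = L2norm f.
Proof. by move=> Au mf; rewrite !L2normE sqnorm_int_dilation. Qed.

Lemma L2_dilation A f : A \in unitmx -> L2 f -> L2 (dilation A f).
Proof.
move=> Au /L2P[mf lf]; apply/L2P; split; first exact: measurable_cfun_dilation.
by rewrite sqnorm_int_dilation.
Qed.

Lemma L2inner_dilation A f g : A \in unitmx ->
  measurable_cfun f -> measurable_cfun g ->
  L2inner (dilation A f) (dilation A g) = L2inner f g.
Proof.
move=> Au mf mg; have [mr mi] := measurable_inner mf mg.
rewrite /L2inner /Rintegral; congr Complex; congr fine.
- rewrite -[RHS](integral_mulmx Au); last exact/measurable_EFinP.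
  by apply: eq_integral => x _; rewrite (dilation_mulJ A _ _ _).1 EFinM.
- rewrite -[RHS](integral_mulmx Au); last exact/measurable_EFinP.
  by apply: eq_integral => x _; rewrite (dilation_mulJ A _ _ _).2 EFinM.
Qed.

Lemma dilationB A f g :
  dilation A (fun x => f x - g x) = (fun x => dilation A f x - dilation A g x).
Proof. by apply/funext => x; rewrite /dilation mulrBr. Qed.

(** The normalizing factors cancel because their squares are |det A| and its
    inverse. *)
Lemma dilationK A : A \in unitmx -> cancel (dilation A) (dilation (invmx A)).
Proof.
move=> Au f; apply/funext => x; rewrite /dilation mulmxA mulmxV// mul1mx mulrA.
rewrite (_ : Complex _ _ * Complex _ _ = 1) ?mul1r// det_inv.
apply/eqP; rewrite eq_complex/= !mulr0 mul0r subr0 addr0 eqxx andbT.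
by rewrite -sqrtrM ?normr_ge0// -normrM mulVf ?normr1 ?sqrtr1// -unitfE -unitmxE.
Qed.

Lemma dilation_translate A (b : V) f :
  dilation A (translate (A *m b) f) = translate b (dilation A f).
Proof. by apply/funext => x; rewrite /dilation /translate mulmxBr. Qed.

(** Each approximation by a linear combination of translates is dilated term by term;
    the error keeps its norm. *)
Lemma dilation_invariant_span A (Lam : set V) F g :
  A \in unitmx -> F `<=` L2 ->
  invariant_span [set A *m v | v in Lam] F g ->
  invariant_span Lam (dilation A @` F) (dilation A g).
Proof.
move=> Au FL2 [L2g clg]; split; first exact: L2_dilation.
move=> e /clg[h Sh he]; exists (dilation A h).
  case: Sh => n [c [k [Tk ->]]]; exists n, c, (fun i => dilation A (k i)); split.
    move=> i; have [_ [psi [[v Lv <-] Fpsi ->]]] := Tk i.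
    by exists v, (dilation A psi); split => //; exact: dilation_translate.
  apply/funext => x; rewrite /dilation mulr_sumr; apply: eq_bigr => i _.
  by rewrite mulrCA.
rewrite -dilationB L2norm_dilation//; apply: measurable_cfunB.
  by move/L2P : L2g => [].
apply: lin_span_measurable Sh => _ [v [psi [_ Fpsi ->]]].
by apply: measurable_cfun_translate; have /L2P[] := FL2 _ Fpsi.
Qed.

Lemma image_mulmxK A (Lam : set V) : A \in unitmx ->
  [set invmx A *m v | v in [set A *m v | v in Lam]] = Lam.
Proof.
move=> Au; rewrite -[RHS]image_id image_comp; apply: eq_imagel => v _ /=.
by rewrite mulmxA mulVmx// mul1mx.
Qed.

Lemma image_dilationK A F : A \in unitmx ->
  dilation (invmx A) @` (dilation A @` F) = F.
Proof.
move=> Au; rewrite -[RHS]image_id image_comp; apply: eq_imagel => f _ /=.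
by rewrite dilationK.
Qed.

(** The nontrivial inclusion is [dilation_invariant_span] for the inverse matrix and
    the lattice A Lam. *)
Lemma invariant_span_dilationE A (Lam : set V) F :
  A \in unitmx -> F `<=` L2 ->
  invariant_span Lam (dilation A @` F) =
  dilation A @` invariant_span [set A *m v | v in Lam] F.
Proof.
move=> Au FL2; apply/seteqP; split => [g|_ [g Sg <-]]; last first.
  exact: dilation_invariant_span.
have Vu : invmx A \in unitmx by rewrite unitmx_inv.
rewrite -{1}(image_mulmxK Lam Au) => /(dilation_invariant_span Vu).
rewrite image_dilationK// => Sg; exists (dilation (invmx A) g).
  by apply: Sg => _ [f Ff <-]; apply: L2_dilation => //; exact: FL2.
by have := dilationK Vu g; rewrite invmxK.
Qed.

(** Dilation preserves inner products, hence orthogonality. *)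
Lemma is_projection_dilation A W f p : A \in unitmx -> W `<=` L2 -> L2 f -> W p ->
  is_orthogonal_projection (dilation A @` W) (dilation A f) (dilation A p) <->
  is_orthogonal_projection W f p.
Proof.
move=> Au WL2 L2f Wp.
have mc w : W w -> measurable_cfun w by move=> /WL2/L2P[].
have mfp : measurable_cfun (fun x => f x - p x).
  by apply: measurable_cfunB; [case/L2P : L2f|exact: mc].
rewrite /is_orthogonal_projection -dilationB; split => -[_ o]; split => //.
- move=> w Ww; rewrite -(L2inner_dilation Au mfp (mc _ Ww)).
  by apply: o; exists w.
- by move=> _ [w Ww <-]; rewrite L2inner_dilation//; [exact: o|exact: mc].
Qed.

(** When a projection exists, the dilation of the selected one is a projection of the
    dilated function, possibly different from the one selected there; the distances
    agree by [projection_dist]. *)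
Lemma dist_dilation A W f : A \in unitmx -> W `<=` L2 -> L2 f ->
  fine (L2norm (fun x => dilation A f x -
    orthogonal_projection (dilation A @` W) (dilation A f) x)) ^+ 2 =
  fine (L2norm (fun x => f x - orthogonal_projection W f x)) ^+ 2.
Proof.
move=> Au WL2 L2f; have /L2P[mf _] := L2f.
rewrite /orthogonal_projection.
have [[p pP]|noP] := pselect (exists p, is_orthogonal_projection W f p).
- have /(xgetPex (fun=> 0)) := ex_intro _ p pP.
  set p' := xget _ _ => p'P; have [Wp' _] := p'P.
  have : exists q, is_orthogonal_projection (dilation A @` W) (dilation A f) q.
    by exists (dilation A p'); apply/is_projection_dilation.
  move=> /(xgetPex (fun=> 0)); set q' := xget _ _ => q'P.
  have [[q Wq qE] _] := q'P; rewrite -qE in q'P *.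
  have qP := (is_projection_dilation Au WL2 L2f Wq).1 q'P.
  rewrite -dilationB L2norm_dilation//; first exact: projection_dist WL2 _ _ _.
  by apply: measurable_cfunB => //; have /L2P[] := WL2 _ Wq.
- rewrite !xgetPN//.
  + under eq_fun do rewrite subr0; under [in RHS]eq_fun do rewrite subr0.
    by rewrite L2norm_dilation.
  + by move=> p pP; apply: noP; exists p.
  + move=> _ /[dup] -[[p Wp <-] _] pP; apply: noP; exists p.
    exact: (is_projection_dilation Au WL2 L2f Wp).1 pP.
Qed.

Lemma approx_errors_dilation (m l : nat) (f : 'I_m -> V -> R[i]) (Lam : set V) A :
  A \in unitmx -> (forall i, L2 (f i)) ->
  [set approx_error f S | S in invariant_subspaces [set A *m v | v in Lam] l] `<=`
  [set approx_error (fun i => dilation A (f i)) S | S in invariant_subspaces Lam l].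
Proof.
move=> Au L2f _ [_ [psi L2psi ->] <-].
have psiL2 : range psi `<=` L2 by move=> _ [j _ <-]; exact: L2psi.
exists (invariant_span Lam (range (fun j => dilation A (psi j)))).
  by exists (fun j => dilation A (psi j)) => // j; exact: L2_dilation.
rewrite -(image_comp psi (dilation A)).
rewrite invariant_span_dilationE//; apply: eq_bigr => i _.
by apply: dist_dilation => // g [].
Qed.

End dilation_L2.

Theorem proposition17 (R : realType) (d m l : nat) (Lam : set 'cV[R]_d)
    (f : 'I_m -> 'cV[R]_d -> R[i]) (A : 'M[R]_d)
    (hLam : full_rank_lattice Lam) (hf : forall i, L2 (f i))
    (hl : (0 < l)%N) (hA : A \in unitmx) :
  optimal_error f [set A *m v | v in Lam] l =
  optimal_error (fun i => dilation A (f i)) Lam l.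
Proof.
rewrite /optimal_error; congr inf; apply/seteqP; split.
  exact: approx_errors_dilation.
have hV : invmx A \in unitmx by rewrite unitmx_inv.
rewrite -{1}(image_mulmxK Lam hA) => e /(approx_errors_dilation hV).
under [X in approx_error X]eq_fun do rewrite dilationK//.
by apply => i; exact: L2_dilation.
Qed.
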